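(* For $r\ge 2$ let $\mathfrak{f}_r(z)=\sum_{n\ge0}\frac{-1}{2n-1}\binom{2n}{n}^r z^n$. Then the series $\{\mathfrak{f}_r\}_{r\ge2}$ are algebraically independent over $\mathbb{Q}(z)$, i.e. for every $l\ge 2$ the series $\mathfrak{f}_2,\dots,\mathfrak{f}_l$ are algebraically independent over $\mathbb{Q}(z)$. *)

(* Defs.v *)
From HB Require Import structures.
From mathcomp Require Import all_boot all_order all_algebra.
From mathcomp Require Import mpoly.
Set Implicit Arguments. Unset Strict Implicit. Unset Printing Implicit Defensive.
Import Order.TTheory GRing.Theory Num.Theory.
Local Open Scope ring_scope.

(* Formal power series in z over Q, represented by their coefficient sequence. *)
Definition series := nat -> rat.

Definition frak_f (r : nat) : series :=
  fun n => - ((('C(n.*2, n) ^ r)%N)%:R) / ((n.*2)%:R - 1).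

Definition trunc (f : series) (N : nat) : {poly rat} := \poly_(i < N) f i.

(* Evaluation of P in Q[z][X_0..X_{n-1}] at (f_0,..,f_{n-1}) in Q[[z]]:
   the k-th coefficient of P(f) only depends on the f_i modulo z^(k+1). *)
Definition series_eval n (P : {mpoly {poly rat}[n]}) (f : 'I_n -> series) : series :=
  fun k => (P.@[fun i => trunc (f i) k.+1])`_k.

(* Algebraic independence over Q[z] (equivalently over Q(z), by clearing denominators). *)
Definition alg_indep_series n (f : 'I_n -> series) : Prop :=
  forall P : {mpoly {poly rat}[n]}, (forall k, series_eval P f k = 0) -> P = 0.

(* Main.v *)
Require Import Defs.
From HB Require Import structures.
From mathcomp Require Import all_boot all_order all_algebra.
From mathcomp Require Import mpoly.
From mathcomp Require Import all_field zify ring.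
Set Implicit Arguments. Unset Strict Implicit. Unset Printing Implicit Defensive.
Import GRing.Theory Num.Theory.
Local Open Scope ring_scope.

(* Reduce modulo a large prime p. Let g_r be the reduction of the series with
   coefficients C(2n,n)^r, and B_r, A_r the truncations below z^p of g_r and
   f_r. Lucas' congruence gives g_r = B_r g_r^p and f_r = A_r g_r^p, so that
   f_r = (A_r / B_r) g_r with g_r^(p-1) = 1 / B_r. A polynomial relation between
   the f_r thus becomes a linear relation between monomials g^m with
   coefficients c_m in K[z], where K is the algebraic closure of F_p. Comparing
   a shortest relation with its image under Frobenius yields
   c_m^(p-1) B^(-m) = c_b^(p-1) B^(-b) for two distinct exponents m and b.
   Every root of B_r has multiplicity less than r, because B_r is a solution of
   the hypergeometric equation of g_r; hence for p large the (p-1)-th powers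
   cancel and B^m = B^b. Finally the B_r are multiplicatively independent,
   because the coefficient of z^k in g_r grows like 4^(rk). *)

(** * Central binomial coefficients: recurrence and bounds *)

Definition cbin (n : nat) : nat := 'C(n.*2, n).

Lemma cbin_gt0 n : (0 < cbin n)%N.
Proof. by rewrite bin_gt0 -addnn leq_addr. Qed.

Lemma cbinS n : (n.+1 * cbin n.+1 = 2 * n.*2.+1 * cbin n)%N.
Proof.
have h1 := mul_bin_diag n.*2.+2 n.
have h2 := mul_bin_diag n.*2.+1 n.
have h3 : 'C(n.*2.+1, n) = 'C(n.*2.+1, n.+1).
  by rewrite -bin_sub -?addnn; [congr 'C(_, _); lia | lia].
rewrite /= in h1 h2; rewrite /cbin doubleS -h1 h3.
have -> : (n.*2.+2 = 2 * n.+1)%N by lia.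
by rewrite -!mulnA h2.
Qed.

Lemma cbin_le n : (cbin n <= 4 ^ n)%N.
Proof.
elim: n => [|n IHn]; first by [].
rewrite -(leq_pmul2l (ltn0Sn n)) cbinS expnS.
have : (2 * n.*2.+1 * cbin n <= 2 * n.*2.+1 * 4 ^ n)%N by rewrite leq_mul2l IHn orbT.
move=> /leq_trans; apply; rewrite mulnA; apply: leq_mul => //; lia.
Qed.

Lemma cbin_ge n : (4 ^ n <= n.*2.+1 * cbin n)%N.
Proof.
elim: n => [|n IHn]; first by [].
have := cbinS n; rewrite expnS; move: IHn; lia.
Qed.

(** * Lucas' congruence and the truncations of g_r modulo p *)

Section Reduction.
Variables (F : fieldType) (p : nat).
Hypothesis charF : p \in [pchar F].

Let p_pr : prime p := pcharf_prime charF.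
Let p_gt0 : (0 < p)%N := prime_gt0 p_pr.

(** Only exponents divisible by p occur in [v \Po 'X^p], so only indices of [u] congruent to j
    contribute, and the hypothesis leaves j alone. *)
Lemma coef_mul_comp_polyXn (u v : {poly F}) j m : (j < p)%N ->
    (forall i, (i <= j + p * m)%N -> i = j %[mod p] -> i != j -> u`_i = 0) ->
  (u * (v \Po 'X^p))`_(j + p * m) = u`_j * v`_m.
Proof.
move=> j_lt u0.
have j_lt' : (j < (j + p * m).+1)%N by rewrite ltnS leq_addr.
rewrite coefM (bigD1 (Ordinal j_lt')) //= big1 => [|i ij].
  by rewrite addr0 coef_comp_poly_Xn // addKn dvdn_mulr // mulKn.
have [/eqP i_mod|] := boolP (i == j %[mod p]).
  by rewrite u0 ?mul0r // -ltnS.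
rewrite coef_comp_poly_Xn //; case: ifP => [dv|]; last by rewrite mulr0.
have i_le : (i <= j + p * m)%N by rewrite -ltnS.
have e : (j + p * m = j %[mod p])%N by rewrite mulnC addnC modnMDl.
by move: dv; rewrite -eqn_mod_dvd // e eq_sym => ->.
Qed.

Lemma coef_XD1n (N i : nat) : ((1 + 'X : {poly F}) ^+ N)`_i = 'C(N, i)%:R.
Proof.
rewrite addrC exprD1n coef_sum.
under eq_bigr => j _ do rewrite coefMn coefXn.
have [i_lt|i_ge] := ltnP i N.+1.
  rewrite (bigD1 (Ordinal i_lt)) //= eqxx big1 ?addr0 // => j ji.
  by rewrite -val_eqE /= eq_sym in ji; rewrite (negPf ji) mul0rn.
rewrite bin_small // big1 // => j _.
have -> : (i == j :> nat) = false by apply/eqP; have := ltn_ord j; lia.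
by rewrite mul0rn.
Qed.

Let charFX : p \in [pchar {poly F}]. Proof. by rewrite pchar_poly. Qed.

(** Compare coefficients in (1 + X)^(2j) (1 + X^p)^(2m). An index i <> j congruent to j is at least
    j + p > 2j, so no condition 2j < p is required. *)
Lemma cbin_lucas j m : (j < p)%N ->
  (cbin (j + p * m))%:R = (cbin j)%:R * (cbin m)%:R :> F.
Proof.
move=> j_lt; rewrite -[LHS]coef_XD1n.
have -> : ((j + p * m).*2 = j.*2 + p * m.*2)%N by lia.
rewrite exprD exprM.
have -> : (1 + 'X) ^+ p = (1 + 'X) \Po 'X^p :> {poly F}.
  rewrite -(pFrobenius_autE charFX) pFrobenius_autD_comm; last exact: mulrC.
  by rewrite pFrobenius_aut1 pFrobenius_autE rmorphD rmorph1 /= comp_polyX.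
rewrite -rmorphXn /= coef_mul_comp_polyXn ?coef_XD1n // => i i_le i_mod ij.
rewrite coef_XD1n bin_small //.
have: (j %% p = j)%N by rewrite modn_small.
move: (divn_eq i p); rewrite i_mod => -> ->.
case: (i %/ p)%N ij (divn_eq i p) => [|k]; last lia.
by rewrite mul0n add0n i_mod modn_small // => /eqP.
Qed.

Definition cser (r N : nat) : {poly F} := \poly_(j < N) (cbin j ^ r)%:R.

(** The coefficients lie in the prime field, which Frobenius fixes. *)
Lemma comp_polyXp_nat (c : nat -> nat) N :
  (\poly_(j < N) (c j)%:R) \Po 'X^p = (\poly_(j < N) (c j)%:R) ^+ p :> {poly F}.
Proof.
rewrite -[RHS](pFrobenius_autE charFX) poly_def !raddf_sum /=.
apply: eq_bigr => j _; rewrite comp_polyZ comp_Xn_poly pFrobenius_autE exprZn.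
by rewrite -(pFrobenius_autE charF) pFrobenius_aut_nat -!exprM mulnC.
Qed.

Lemma coef_poly_split (u v : {poly F}) j m : (j < p)%N -> (size u <= p)%N ->
  (u * (v \Po 'X^p))`_(j + p * m) = u`_j * v`_m.
Proof.
move=> j_lt su; apply: coef_mul_comp_polyXn => // i _ i_mod ij.
apply: nth_default; apply: leq_trans su _; rewrite leqNgt; apply/negP=> i_lt.
by move: i_mod ij; rewrite !modn_small // => ->; rewrite eqxx.
Qed.

(** Truncated form of g_r = B_r g_r^p; cutting at powers of p makes it an exact identity of
    polynomials. *)
Lemma cserS r s : cser r (p ^ s.+1) = cser r p * cser r (p ^ s) ^+ p.
Proof.
rewrite -comp_polyXp_nat; apply/polyP => n.
have j_lt : (n %% p < p)%N by rewrite ltn_mod.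
rewrite (divn_eq n p) mulnC addnC coef_poly_split ?size_poly // !coef_poly j_lt.
have -> : (n %% p + p * (n %/ p) < p ^ s.+1)%N = (n %/ p < p ^ s)%N.
  by rewrite addnC mulnC -divn_eq expnS mulnC ltn_divLR.
case: ifP => _; last by rewrite mulr0.
by rewrite !natrX cbin_lucas // exprMn.
Qed.

End Reduction.

(** * Integrality of the coefficients of f_r and their congruences *)

(* The n-th coefficient of frak_f r, for r > 0: an integer because 2n - 1 divides
   C(2n,n). *)
Definition fcoef (r n : nat) : int :=
  (if n is 0 then 1 else - (cbin n %/ n.*2.-1)%:Z) * (cbin n ^ r.-1)%:Z.

(** By [cbinS], since 2n + 1 is coprime to n + 1. *)
Lemma dvdn_cbin n : (0 < n)%N -> (n.*2.-1 %| cbin n)%N.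
Proof.
case: n => // n _; rewrite doubleS /=.
rewrite -(@Gauss_dvdr n.*2.+1 n.+1); first by rewrite cbinS -mulnA mulnCA dvdn_mulr.
have -> : (n.*2.+1 = n + n.+1)%N by lia.
by rewrite /coprime gcdnC gcdnDr; exact: coprimeSn.
Qed.

Lemma fcoefE r n : (0 < r)%N ->
  fcoef r n * ((n.*2)%:R - 1) = - (cbin n ^ r)%:Z.
Proof.
case: r => // r _; rewrite /fcoef /= expnS PoszM.
case: n => [|n]; first by rewrite /cbin bin0; lia.
rewrite mulrAC -mulNr; congr (_ * _).
have /divnK {2}<- := dvdn_cbin (ltn0Sn n).
rewrite mulNr PoszM; congr (- (_ * _)).
by rewrite natz doubleS /=; lia.
Qed.

Lemma frak_fE r n : (0 < r)%N -> frak_f r n = (fcoef r n)%:~R.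
Proof.
move=> r_gt0; rewrite /frak_f.
have nz : (n.*2)%:R - 1 != 0 :> rat.
  rewrite subr_eq0 (_ : 1 = 1%:R) // eqr_nat; lia.
apply: (mulIf nz); rewrite divfK //.
have := congr1 (fun z : int => z%:~R : rat) (fcoefE n r_gt0).
by rewrite intrM intrB intrN natz -!pmulrn => ->.
Qed.

Section FReduction.
Variables (F : fieldType) (p : nat).
Hypothesis charF : p \in [pchar F].

Let p_pr : prime p := pcharf_prime charF.
Let p_gt0 : (0 < p)%N := prime_gt0 p_pr.

Lemma fcoef_lucas r j m : (1 < r)%N -> (j < p)%N ->
  (fcoef r (j + p * m))%:~R = (fcoef r j)%:~R * (cbin m ^ r)%:R :> F.
Proof.
move=> r_gt1 j_lt.
have r_gt0 : (0 < r)%N by apply: ltnW.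
have fE n : (fcoef r n)%:~R * ((n.*2)%:R - 1) = - (cbin n ^ r)%:R :> F.
  have := congr1 (fun z : int => z%:~R : F) (fcoefE n r_gt0).
  by rewrite intrM intrB intrN natz -!pmulrn.
have eD : ((j + p * m).*2)%:R = (j.*2)%:R :> F.
  by rewrite doubleD natrD -[(p * m).*2]mul2n mulnCA natrM (pcharf0 charF) mul0r addr0.
(* The factor 2n - 1 depends only on n modulo p and cancels unless p divides 2j - 1. In that case p
   divides [cbin j], and both sides vanish because r > 1 leaves a factor [cbin] in [fcoef]. *)
have [j0|j0] := eqVneq ((j.*2)%:R - 1 : F) 0; last first.
  apply: (mulIf j0); rewrite -{1}eD fE mulrAC fE mulNr.
  by rewrite !natrX cbin_lucas // exprMn.
have cj : (cbin j)%:R = 0 :> F.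
  case: j {j_lt eD} j0 => [|j j0].
    by move/eqP; rewrite sub0r oppr_eq0 oner_eq0.
  apply/eqP; rewrite -(dvdn_pcharf charF); apply: dvdn_trans (dvdn_cbin _) => //.
  by rewrite (dvdn_pcharf charF) doubleS /= -j0 doubleS
    -(natrB _ (isT : (0 < _.+2)%N)) subn1.
have f0 n : (cbin n)%:R = 0 :> F -> (fcoef r n)%:~R = 0 :> F.
  move=> c0; rewrite /fcoef intrM -pmulrn natrX c0 expr0n.
  by case: r r_gt1 {r_gt0 fE} => [|[|r]] //= _; rewrite mulr0.
by rewrite !f0 ?mul0r // cbin_lucas // cj mul0r.
Qed.

Definition fser (r N : nat) : {poly F} := \poly_(j < N) (fcoef r j)%:~R.

Lemma fserS r s : (1 < r)%N -> fser r (p ^ s.+1) = fser r p * cser F r (p ^ s) ^+ p.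
Proof.
move=> r_gt1; rewrite -(comp_polyXp_nat charF); apply/polyP => n.
have j_lt : (n %% p < p)%N by rewrite ltn_mod.
rewrite (divn_eq n p) mulnC addnC (coef_poly_split charF) ?size_poly // !coef_poly j_lt.
have -> : (n %% p + p * (n %/ p) < p ^ s.+1)%N = (n %/ p < p ^ s)%N.
  by rewrite addnC mulnC -divn_eq expnS mulnC ltn_divLR.
case: ifP => _; last by rewrite mulr0.
by rewrite fcoef_lucas.
Qed.

Lemma fser_cser r s : (1 < r)%N ->
  cser F r p * fser r (p ^ s.+1) = fser r p * cser F r (p ^ s.+1).
Proof. by move=> r_gt1; rewrite fserS // (cserS charF) mulrCA. Qed.

End FReduction.

(** * Coefficient growth and multiplicative independence of the B_r *)

Lemma leq_exp2r_weak m n e : (m <= n)%N -> (m ^ e <= n ^ e)%N.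
Proof. by case: e => [|e] // mn; rewrite leq_exp2r. Qed.

Lemma exp_lt_exp4 E : exists k, ((2 * k).+1 ^ E < 4 ^ k)%N.
Proof.
(* Then 2k + 1 <= 2^(E+4) and 4^k = 2^(2^(E+3)), so it suffices that (E + 4) E < 8 * 2^E. *)
exists (2 ^ E.+2)%N.
have h1 : ((2 * 2 ^ E.+2).+1 <= 2 ^ E.+4)%N.
  by rewrite -expnS [in leqRHS]expnS mul2n -addnn -addn1 leq_add2l expn_gt0.
apply: leq_ltn_trans (leq_exp2r_weak E h1) _.
rewrite (_ : 4 = 2 ^ 2)%N // -!expnM ltn_exp2l // -expnS.
have: (E.+4 * E < 8 * 2 ^ E)%N.
  elim: E {h1} => [|E IH] //; rewrite expnS.
  have : (E < 2 ^ E)%N by apply: ltn_expl.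
  by move: IH; move: (2 ^ E)%N => x; nia.
by rewrite (_ : 8 = 2 ^ 3)%N // -expnD.
Qed.

(** Lift of [cser] to natural coefficients, where sizes can be compared. *)
Definition nser (r N : nat) : {poly nat} := \poly_(j < N) (cbin j ^ r)%N.

(** The power of k + 1 absorbs the number of terms in convolutions: each further factor costs one
    unit of M. *)
Definition coef_growth (C M : nat) (u : {poly nat}) :=
  forall k, ((u`_k)%R <= k.+1 ^ M * C ^ k)%N.

Lemma coef_growthM C M u v :
  coef_growth C 0 u -> coef_growth C M v -> coef_growth C M.+1 (u * v).
Proof.
move=> hu hv k; rewrite coefM expnS -mulnA.
apply: (@leq_trans (\sum_(j < k.+1) k.+1 ^ M * C ^ k)%N); last first.
  by rewrite sum_nat_const card_ord.
apply: leq_sum => j _; have j_le : (j <= k)%N by rewrite -ltnS.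
apply: leq_trans (leq_mul (hu j) (hv _)) _.
rewrite expn0 mul1n mulnCA -expnD subnKC // leq_mul2r leq_exp2r_weak ?orbT //.
by rewrite ltnS leq_subr.
Qed.

Lemma coef_growthXM C M e u v :
  coef_growth C 0 u -> coef_growth C M v -> coef_growth C (e + M) (u ^+ e * v).
Proof.
move=> hu hv; elim: e => [|e IH]; first by rewrite mul1r.
by rewrite exprS -mulrA addSn; apply: coef_growthM.
Qed.

Lemma coef_growthW C M M' u : (M <= M')%N ->
  coef_growth C M u -> coef_growth C M' u.
Proof.
move=> hM hu k; apply: leq_trans (hu k) _.
by rewrite leq_mul2r leq_pexp2l ?orbT.
Qed.

Lemma coef_growth_nser r r' N : (r <= r')%N -> coef_growth (4 ^ r') 0 (nser r N).
Proof.
move=> hr k; rewrite coef_poly expn0 mul1n.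
case: ifP => // _; rewrite -expnM mulnC expnM.
apply: leq_trans (leq_pexp2l _ hr) _; first exact: cbin_gt0.
exact/leq_exp2r_weak/cbin_le.
Qed.

Lemma coef_growth_prod_nser n D (e : nat -> nat) N : (forall i, e i <= D)%N ->
  coef_growth (4 ^ n.+1) (n * D) (\prod_(i < n) nser (i + 2) N ^+ e i).
Proof.
move=> he; suff gen m : (m <= n)%N ->
  coef_growth (4 ^ n.+1) (m * D) (\prod_(i < m) nser (i + 2) N ^+ e i) by apply: gen.
elim: m => [_ k|m IH mn].
  rewrite big_ord0 mul0n expn0 mul1n coef1.
  by case: k => [|k] //=; rewrite expn0.
rewrite big_ord_recr /= mulrC mulSn.
apply: (@coef_growthW _ (e m + m * D)); first by rewrite leq_add2r.
apply: coef_growthXM; last by apply: IH; lia.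
by apply: coef_growth_nser; lia.
Qed.

Section Growth.
Variables (F : fieldType) (p : nat).
Hypothesis charF : p \in [pchar F].

Lemma map_nser r N : map_poly (GRing.natmul 1) (nser r N) = cser F r N.
Proof.
apply/polyP => j; rewrite coef_map !coef_poly /=.
by case: ifP.
Qed.

Lemma map_prod_nser n (e : nat -> nat) N :
  map_poly (GRing.natmul 1) (\prod_(i < n) nser (i + 2) N ^+ e i) =
  \prod_(i < n) cser F (i + 2) N ^+ e i.
Proof.
rewrite rmorph_prod; apply: eq_bigr => i _.
by rewrite rmorphXn /= map_nser.
Qed.

Lemma natr_inj_small a b : (a < p)%N -> (b < p)%N -> a%:R = b%:R :> F -> a = b.
Proof.
wlog ab : a b / (a <= b)%N => [hw ha hb e|ha hb e].
  by case: (leqP a b) => [|/ltnW] h; [|symmetry]; apply: hw.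
have: (b - a)%:R == 0 :> F by rewrite natrB // e subrr.
rewrite -(dvdn_pcharf charF); case: (posnP (b - a)) => [|h /(dvdn_leq h)]; lia.
Qed.

Lemma cser_neq0 r N : (0 < N)%N -> cser F r N != 0.
Proof.
move=> N0; apply/eqP => /(congr1 (fun u : {poly F} => u`_0)).
by rewrite coef_poly N0 coef0 /cbin bin0 exp1n => /eqP; rewrite oner_eq0.
Qed.

Variables (n D k : nat).
Hypothesis k_big : ((2 * k).+1 ^ (n.+1 + n * D) < 4 ^ k)%N.
Hypothesis p_big : (k.+1 ^ (n * D) * 4 ^ (n.+1 * k) < p)%N.

Let p_gt0 : (0 < p)%N := prime_gt0 (pcharf_prime charF).

Let k_lt_p : (k < p)%N.
Proof.
apply: leq_ltn_trans p_big; apply: (@leq_trans (4 ^ (n.+1 * k))); last first.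
  by rewrite leq_pmull ?expn_gt0.
apply: leq_trans (ltnW (ltn_expl k (isT : 1 < 4)%N)) _.
by rewrite leq_exp2l // leq_pmull.
Qed.

(* The coefficient of z^k on the left exceeds C(2k,k)^(m+2), while on the right
   it is at most of order 4^((m+1)k). *)
Lemma cserX_mul_neq m d (e e' : nat -> nat) : (m < n)%N -> (d < D)%N ->
    (forall i, e i <= D)%N -> (forall i, e' i <= D)%N ->
  cser F (m + 2) p ^+ d.+1 * \prod_(i < m) cser F (i + 2) p ^+ e i !=
  \prod_(i < m) cser F (i + 2) p ^+ e' i.
Proof.
move=> mn dD he he'; apply/eqP; rewrite -!map_prod_nser -map_nser -rmorphXn -rmorphM.
move=> /(congr1 (fun u : {poly F} => u`_k)); rewrite !coef_map /=.
set L := (X in X%:R = _); set R := (X in _ = X%:R) => LR.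
have Rle : (R <= k.+1 ^ (n * D) * 4 ^ (m.+1 * k))%N.
  have := coef_growth_prod_nser m p he' k; rewrite -expnM => /leq_trans; apply.
  by rewrite leq_mul2r leq_pexp2l ?orbT // leq_mul2r (ltnW mn) orbT.
have Lle : (L <= k.+1 ^ (n * D) * 4 ^ (m.+2 * k))%N.
  rewrite (expnM 4); suff: coef_growth (4 ^ m.+2) (n * D)
    (nser (m + 2) p ^+ d.+1 * \prod_(i < m) nser (i + 2) p ^+ e i) by move/(_ k).
  apply: (@coef_growthW _ (d.+1 + m * D)); first by
    apply: leq_trans (leq_mul mn (leqnn D)); rewrite mulSn leq_add2r.
  apply: coef_growthXM; first by apply: coef_growth_nser; rewrite addn2.
  move=> j; apply: leq_trans (coef_growth_prod_nser m p he j) _.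
  by rewrite leq_mul2l; apply/orP; right; apply: leq_exp2r_weak; rewrite leq_exp2l.
(* All terms of the convolution are nonnegative and the other constant terms are 1, so one factor's
   coefficient of z^k is a lower bound. *)
have Lge : (cbin k ^ m.+2 <= L)%N.
  rewrite /L exprS -mulrA coefM big_ord_recr /= subnn.
  apply: leq_trans (leq_addl _ _).
  rewrite coef_poly k_lt_p addn2 coef0M coef0_prod.
  have c0 r : (nser r p)`_0 = 1 by rewrite coef_poly p_gt0 /cbin bin0 exp1n.
  have cX r a : (nser r p ^+ a)`_0 = 1.
    by elim: a => [|a IHa]; rewrite ?coef1 // exprS coef0M c0 IHa mulr1.
  by rewrite cX big1 // !mulr1.
have lt_p a : (a <= n.+1)%N -> (k.+1 ^ (n * D) * 4 ^ (a * k) < p)%N.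
  move=> an; apply: leq_ltn_trans p_big.
  by rewrite leq_mul2l leq_exp2l // leq_mul2r an !orbT.
(* Both numbers are below p, so equality in F lifts to the integers. *)
have {}LR : L = R.
  apply: natr_inj_small LR; apply: leq_ltn_trans; first exact: Lle.
  - exact: lt_p.
  - exact: Rle.
  - by apply: lt_p; lia.
(* With 4^k <= (2k + 1) C(2k,k), the equality would give 4^k <= (2k + 1)^(n + 1 + nD), against
   [k_big]. *)
have h4 := leq_exp2r_weak m.+2 (cbin_ge k).
have : (4 ^ (m.+2 * k) <= (2 * k).+1 ^ (n.+1 + n * D) * 4 ^ (m.+1 * k))%N.
  rewrite [(m.+2 * k)%N]mulnC expnM; apply: leq_trans h4 _; rewrite expnMn.
  apply: leq_trans (leq_mul (leqnn _) (leq_trans Lge (_ : L <= _)%N)) _.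
    by rewrite LR; exact: Rle.
  rewrite mulnA leq_mul2r expnD; apply/orP; right; apply: leq_mul.
    by rewrite mul2n leq_pexp2l.
  apply: leq_exp2r_weak; lia.
rewrite [(m.+2 * k)%N]mulSn expnD leq_mul2r expn_eq0 /=.
by rewrite leqNgt k_big.
Qed.

(** The factor of largest index grows fastest, so [cserX_mul_neq] forces its two exponents to agree;
    cancel it and induct. *)
Lemma prod_cser_inj (e e' : nat -> nat) :
    (forall i, e i <= D)%N -> (forall i, e' i <= D)%N ->
    \prod_(i < n) cser F (i + 2) p ^+ e i = \prod_(i < n) cser F (i + 2) p ^+ e' i ->
  forall i, (i < n)%N -> e i = e' i.
Proof.
move=> he he'; suff gen m : (m <= n)%N ->
    \prod_(i < m) cser F (i + 2) p ^+ e i = \prod_(i < m) cser F (i + 2) p ^+ e' i ->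
  forall i, (i < m)%N -> e i = e' i by apply: gen.
have cX r a : cser F r p ^+ a != 0 by rewrite expf_neq0 ?cser_neq0.
elim: m => [|m IH] // mn; rewrite !big_ord_recr /= => E.
have em : e m = e' m.
  wlog lt : e e' he he' E {IH} / (e' m < e m)%N => [hw|].
    by case: (ltngtP (e m) (e' m)) => // h; [symmetry|]; apply: hw.
  have dD : ((e m - e' m).-1 < D)%N by have := he m; lia.
  have /eqP[] := cserX_mul_neq mn dD he he'; apply: (mulIf (cX (m + 2) (e' m))).
  rewrite -E [RHS]mulrC mulrAC -exprD; congr (_ ^+ _ * _); lia.
move: E; rewrite em => /(mulIf (cX _ _)) E i; rewrite ltnS leq_eqVlt.
by case/orP => [/eqP -> //|]; apply: IH => //; lia.
Qed.

End Growth.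

(** * Multiplicities of the roots of B_r *)

Section Multiplicity.
Variables (F : fieldType) (p q r : nat).
Hypothesis charF : p \in [pchar F].
Hypothesis p_odd : p = q.*2.+1.
Hypothesis q_gt0 : (0 < q)%N.
Hypothesis r_gt1 : (1 < r)%N.

Let natF_neq0 a : (0 < a < p)%N -> a%:R != 0 :> F.
Proof.
case/andP => a0 ap; rewrite -(dvdn_pcharf charF).
by apply/negP => /(dvdn_leq a0); rewrite leqNgt ap.
Qed.

Let two_neq0 : 2%:R != 0 :> F. Proof. by apply: natF_neq0; lia. Qed.

(** The recurrence produces the factor 2q + 1 = p at j = q, and the zero then propagates. *)
Lemma cbin_eq0 j : (q < j < p)%N -> (cbin j)%:R = 0 :> F.
Proof.
elim: j => [|j IH] // /andP[qj jp].
have j_neq0 : j.+1%:R != 0 :> F by apply: natF_neq0.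
apply: (mulfI j_neq0); rewrite -natrM cbinS mulr0 natrM.
have [jq|jq] := eqVneq j q.
  by rewrite jq -p_odd natrM (pcharf0 charF) mulr0 mul0r.
by rewrite IH ?mulr0 //; apply/andP; split; lia.
Qed.

Variable a : F.

(* The functional h |-> (h(z d/dz) B)(a), where B is the reduction mod p of
   the series with coefficients C(2n,n)^r. *)
Definition theta_eval (h : {poly F}) : F :=
  \sum_(j < p) (cbin j ^ r)%:R * a ^+ j * h.[j%:R].

Lemma theta_eval_coef m (h : {poly F}) : (size h <= m)%N ->
  theta_eval h = \sum_(i < m) h`_i * theta_eval 'X^i.
Proof.
move=> hm; rewrite /theta_eval.
under eq_bigr => j _ do rewrite (horner_coef_wide _ hm) mulr_sumr.
rewrite exchange_big /=; apply: eq_bigr => i _; rewrite mulr_sumr.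
by apply: eq_bigr => j _; rewrite hornerXn mulrCA.
Qed.

Lemma theta_evalB g h : theta_eval (g - h) = theta_eval g - theta_eval h.
Proof.
rewrite /theta_eval -sumrB; apply: eq_bigr => j _.
by rewrite hornerD hornerN mulrBr.
Qed.

Lemma theta_evalZ c h : theta_eval (c *: h) = c * theta_eval h.
Proof.
rewrite /theta_eval mulr_sumr; apply: eq_bigr => j _.
by rewrite hornerZ mulrCA.
Qed.

(** This is (X + 1/2)^r (X + 1)^k, written through its roots so that the two top coefficients can be
    read off. *)
Let halves k : {poly F} :=
  \prod_(x <- nseq r (- 2%:R^-1) ++ nseq k (-1)) ('X - x%:P).

Let prod_nseq k (x y : F) :
  (\prod_(z <- nseq k x) ('X - z%:P)).[y] = (y - x) ^+ k.
Proof.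
rewrite big_nseq; elim: k => [|k IH]; first by rewrite hornerC.
by rewrite iterS hornerM IH hornerXsubC exprS.
Qed.

(* Read off from (n+1)^r b_(n+1) = 4^r (n+1/2)^r b_n. *)
Lemma theta_eval_rec k :
  theta_eval 'X^(r + k) = a * 4%:R ^+ r * theta_eval (halves k).
Proof.
(* Shift the index by one: the term j = 0 on the left vanishes because r + k > 0, the term j = p - 1
   on the right because [cbin] vanishes there. *)
have pE : p = q.*2.-1.+2 by rewrite p_odd; lia.
rewrite /theta_eval [in LHS]pE [in RHS]pE [LHS]big_ord_recl [in RHS]big_ord_recr /=.
rewrite hornerXn expr0n addn_eq0 (gtn_eqF (ltnW r_gt1)) mulr0 add0r.
rewrite natrX cbin_eq0; last by rewrite pE; apply/andP; split; lia.
rewrite expr0n (gtn_eqF (ltnW r_gt1)) !mul0r addr0 mulr_sumr.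
apply: eq_bigr => j _; rewrite /bump /= add1n hornerXn.
rewrite /halves big_cat hornerM !prod_nseq !opprK exprD.
rewrite [j%:R + 1]natr1 !natrX.
have -> : (cbin j.+1)%:R ^+ r * a ^+ j.+1 * (j.+1%:R ^+ r * j.+1%:R ^+ k) =
  (j.+1 * cbin j.+1)%:R ^+ r * (a ^+ j.+1 * j.+1%:R ^+ k) :> F.
  by rewrite natrM exprMn; ring.
rewrite cbinS.
have -> : (2 * j.*2.+1 * cbin j)%:R = 4%:R * (cbin j)%:R * (j%:R + 2%:R^-1) :> F.
  rewrite -mul2n -addn1 !(natrM, natrD).
by field.
by rewrite !exprMn exprS; ring.
Qed.

Let size_halves k : size (halves k) = (r + k).+1.
Proof. by rewrite size_prod_XsubC size_cat !size_nseq. Qed.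

Let coef_halves k : (halves k)`_(r + k) = 1.
Proof.
have mon : halves k \is monic by exact: monic_prod_XsubC.
have := monicP mon.
by rewrite lead_coefE size_halves.
Qed.

Let subcoef_halves k : (halves k)`_(r + k).-1 = (r + 2 * k)%:R / 2%:R.
Proof.
have := @coefPn_prod_XsubC F (nseq r (- 2%:R^-1) ++ nseq k (-1)).
rewrite size_cat !size_nseq addn_eq0 (gtn_eqF (ltnW r_gt1)) => /(_ isT) ->.
rewrite big_cat !big_nseq /=.
have it n (x : F) : iter n (+%R x) 0 = x * n%:R by rewrite iter_addr_0 mulr_natr.
rewrite !it natrD natrM.
by field.
Qed.

Lemma theta_eval_step m : (r <= m <= q)%N ->
  (forall i, (i < m)%N -> theta_eval 'X^i = 0) -> theta_eval 'X^m = 0.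
Proof.
case/andP => rm mq van; set c := a * 4%:R ^+ r.
have vanT (T : {poly F}) : (size T <= m.+1)%N -> T`_m != 0 -> theta_eval T = 0 -> theta_eval 'X^m = 0.
  move=> sT Tm; rewrite (theta_eval_coef sT) big_ord_recr /= big1 ?add0r.
    by move/eqP; rewrite mulf_eq0 (negPf Tm) => /eqP.
  by move=> i _; rewrite van ?mulr0.
have T0 k : theta_eval ('X^(r + k) - c *: halves k) = 0.
  by rewrite theta_evalB theta_evalZ theta_eval_rec subrr.
(* For c <> 1, taking k = m - r gives a relation of degree m with leading coefficient 1 - c. *)
have [c1|c1] := eqVneq c 1; last first.
  apply: vanT (T0 (m - r)%N); rewrite subnKC //.
    rewrite (leq_trans (size_polyD _ _)) // geq_max size_polyXn leqnn size_polyN.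
    by rewrite (leq_trans (size_scale_leq _ _)) // size_halves subnKC.
  have := coef_halves (m - r); rewrite subnKC // => cm.
  by rewrite coefB coefXn eqxx coefZ cm mulr1 subr_eq0 eq_sym.
(* At the singular point c = 1 take k = m - r + 1: degree m + 1 cancels, and X^m has coefficient
   -(2m - r + 2)/2, nonzero because 0 < 2m - r + 2 < p. *)
have mk : (r + (m - r).+1 = m.+1)%N by lia.
apply: vanT (T0 (m - r).+1); rewrite c1 scale1r mk.
  apply/leq_sizeP => i; rewrite leq_eqVlt => /orP[/eqP <-|im].
    by rewrite coefB coefXn eqxx -mk coef_halves subrr.
  rewrite coefB coefXn gtn_eqF // sub0r nth_default ?oppr0 //.
  by rewrite size_halves mk.
have := subcoef_halves (m - r).+1; rewrite mk coefB coefXn /= => ->.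
rewrite ltn_eqF // sub0r oppr_eq0 mulf_neq0 ?invr_eq0 //.
by apply: natF_neq0; rewrite p_odd; apply/andP; split; lia.
Qed.

(** The polynomial (X - 1)...(X - q) kills the terms 1 <= j <= q, and those beyond q vanish by
    [cbin_eq0]; its value at 0 survives and is nonzero. *)
Lemma theta_eval_nontrivial :
  ~ (forall i, (i <= q)%N -> theta_eval 'X^i = 0).
Proof.
move=> van; pose h : {poly F} := \prod_(i <- iota 1 q) ('X - i%:R%:P).
have sh : (size h <= q.+1)%N.
  rewrite /h -(big_map (GRing.natmul 1) xpredT (fun x : F => 'X - x%:P)).
  by rewrite size_prod_XsubC size_map size_iota.
have : theta_eval h = 0.
  by rewrite (theta_eval_coef sh) big1 // => i _; rewrite van ?mulr0 // -ltnS.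
have p0 : (0 < p)%N by rewrite p_odd.
rewrite /theta_eval (bigD1 (Ordinal p0)) //= big1 => [|j j0].
  rewrite addr0 /cbin bin0 exp1n expr0 !mul1r => /eqP; apply/negP.
  rewrite horner_prod prodf_seq_neq0; apply/allP => i; rewrite mem_iota => iq.
  rewrite hornerXsubC sub0r oppr_eq0; apply: natF_neq0; rewrite p_odd; lia.
have [jq|jq] := leqP j q; last first.
  by rewrite natrX cbin_eq0 ?jq ?ltn_ord // expr0n (gtn_eqF (ltnW r_gt1)) !mul0r.
have ji : (j : nat) \in iota 1 q.
  rewrite mem_iota; move: j0; rewrite -val_eqE /=; lia.
by rewrite horner_prod (big_rem _ ji) /= hornerXsubC subrr mul0r mulr0.
Qed.

(** The operator z d/dz lowers the multiplicity of a root by at most one. *)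
Lemma theta_eval_dvd m : ('X - a%:P) ^+ m %| cser F r p ->
  forall i, (i < m)%N -> theta_eval 'X^i = 0.
Proof.
move=> dv i im; pose th (u : {poly F}) := 'X * u^`().
have thdv n u : ('X - a%:P) ^+ n.+1 %| u -> ('X - a%:P) ^+ n %| th u.
  case/dvdpP => w ->; rewrite /th derivM deriv_exp derivXsubC mul1r /=.
  rewrite dvdp_mull // dvdp_add //; last by rewrite -mulr_natl !dvdp_mull.
  by rewrite exprSr mulrA dvdp_mulr // dvdp_mulIr.
have itdv : ('X - a%:P) ^+ (m - i) %| iter i th (cser F r p).
  elim: i im => [|i IH] im; first by rewrite subn0.
  have e : ((m - i.+1).+1 = m - i)%N by lia.
  by rewrite iterS; apply: thdv; rewrite e; exact: IH (ltnW im).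
have : root (iter i th (cser F r p)) a.
  rewrite -dvdp_XsubCl; apply: dvdp_trans itdv.
  by rewrite -{1}['X - _]expr1 dvdp_exp2l // subn_gt0.
move/rootP => <-.
have cf j : (iter i th (cser F r p))`_j = (cser F r p)`_j * j%:R ^+ i.
  elim: i {im itdv} j => [|i IH] j; first by rewrite mulr1.
  rewrite iterS coefXM coef_deriv; case: j => [|j] /=.
    by rewrite exprS mul0r mulr0.
  by rewrite IH exprSr mulrA mulr_natr.
have sz : (size (iter i th (cser F r p)) <= p)%N.
  by apply/leq_sizeP => j pj; rewrite cf coef_poly ltnNge pj mul0r.
rewrite (horner_coef_wide _ sz); apply: eq_bigr => j _.
by rewrite cf coef_poly ltn_ord hornerXn mulrAC.
Qed.

(** Multiplicity r would annihilate X^i for all i < r, hence by [theta_eval_step] for all i <= q,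
    against [theta_eval_nontrivial]. *)
Lemma mup_cser_lt : (mup a (cser F r p) < r)%N.
Proof.
rewrite ltnNge mup_geq; last by rewrite cser_neq0 // p_odd.
apply/negP => /theta_eval_dvd van; apply: theta_eval_nontrivial.
suff gen m : (m <= q.+1)%N -> forall i, (i < m)%N -> theta_eval 'X^i = 0.
  by move=> i iq; apply: (gen q.+1).
elim: m => [|m IH] // mq i; rewrite ltnS leq_eqVlt => /orP[/eqP -> |im].
  have [rm|mr] := leqP r m; last exact: van.
  by apply: theta_eval_step; [rewrite rm -ltnS | apply: IH; apply: ltnW].
by apply: IH => //; apply: ltnW.
Qed.

End Multiplicity.

(** * Linear independence of the monomials in the g_r over K[z] *)

Section Independence.
Variables (K : closedFieldType) (p q n D k : nat).
Hypothesis charK : p \in [pchar K].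
Hypothesis p_odd : p = q.*2.+1.
Hypothesis q_gt0 : (0 < q)%N.
Hypothesis k_big : ((2 * k).+1 ^ (n.+1 + n * D) < 4 ^ k)%N.
Hypothesis p_big : (k.+1 ^ (n * D) * 4 ^ (n.+1 * k) < p)%N.
Hypothesis p_mult : (n * (D * n) < p.-1)%N.

Let p_gt0 : (0 < p)%N. Proof. by rewrite p_odd. Qed.

Local Notation B i := (cser K (i + 2) p).

(** Each of the n factors contributes at most D times i + 1 <= n, by [mup_cser_lt]. *)
Lemma mup_prod_cser a (e : nat -> nat) : (forall i, e i <= D)%N ->
  (mup a (\prod_(i < n) B i ^+ e i) < p.-1)%N.
Proof.
move=> he; apply: leq_ltn_trans p_mult.
suff gen m : (m <= n)%N -> (mup a (\prod_(i < m) B i ^+ e i) <= m * (D * n))%N by exact: gen.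
have B0 i j : B i ^+ j != 0 by rewrite expf_neq0 ?cser_neq0.
have muX i j : (mup a (B i ^+ j) = j * mup a (B i))%N.
  elim: j => [|j IH]; first by rewrite mupNroot // root1.
  by rewrite exprS mupM ?IH ?mulSn // cser_neq0.
elim: m => [|m IH] mn; first by rewrite big_ord0 mupNroot // root1.
rewrite big_ord_recr /= mupM //; last by apply/prodf_neq0 => i _.
rewrite mulSn addnC leq_add //; last by apply: IH; apply: ltnW.
rewrite muX leq_mul //.
have m2 : (1 < m + 2)%N by rewrite addn2.
by have := mup_cser_lt charK p_odd q_gt0 m2 a; lia.
Qed.

Lemma cser_exp_dvd (v : {poly K}) (e : nat -> nat) : (forall i, e i <= D)%N ->
  v ^+ p.-1 %| \prod_(i < n) B i ^+ e i -> size v = 1%N.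
Proof.
move=> he dv; apply/eqP/negPn/negP => /closed_rootP[a].
rewrite -dvdp_XsubCl => /(dvdp_exp2r p.-1) /dvdp_trans /(_ dv).
rewrite -mup_geq; last by apply/prodf_neq0 => i _; rewrite expf_neq0 ?cser_neq0.
by rewrite leqNgt mup_prod_cser.
Qed.

Lemma coef0_prod_cser (e : nat -> nat) : (\prod_(i < n) B i ^+ e i)`_0 = 1.
Proof.
rewrite -horner_coef0 horner_prod big1 // => i _.
by rewrite horner_exp horner_coef0 coef_poly p_gt0 /cbin bin0 exp1n expr1n.
Qed.

(** After division by the gcd, each (p-1)-th power divides a product of B's, so its base is constant
    by [cser_exp_dvd]. Constant terms 1 make the two scalars equal, and [prod_cser_inj] applies. *)
Lemma exp_prod_cser_inj (u v : {poly K}) (e e' : nat -> nat) :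
    (forall i, e i <= D)%N -> (forall i, e' i <= D)%N -> u != 0 -> v != 0 ->
    u ^+ p.-1 * \prod_(i < n) B i ^+ e i = v ^+ p.-1 * \prod_(i < n) B i ^+ e' i ->
  forall i, (i < n)%N -> e i = e' i.
Proof.
move=> he he' u0 v0 E.
have g0 : gcdp u v != 0 by rewrite gcdp_eq0 negb_and u0.
have cop := coprimep_div_gcd (introT orP (or_introl u0) : (u != 0) || (v != 0)).
move: (divpK (dvdp_gcdl u v)) (divpK (dvdp_gcdr u v)) cop.
move: (u %/ _) (v %/ _) => x y xE yE cop.
have {}E : x ^+ p.-1 * \prod_(i < n) B i ^+ e i = y ^+ p.-1 * \prod_(i < n) B i ^+ e' i.
  apply: (mulfI (expf_neq0 p.-1 g0)); rewrite !mulrA -!exprMn.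
  by rewrite ![gcdp u v * _]mulrC xE yE.
have copX : coprimep (y ^+ p.-1) (x ^+ p.-1).
  by rewrite coprimep_expl ?coprimep_expr // coprimep_sym.
have /size_poly1P[d d0 dE] : size y == 1%N.
  apply/eqP/(cser_exp_dvd he); rewrite -(Gauss_dvdpr _ copX) E; exact: dvdp_mulr.
have /size_poly1P[c c0 cE] : size x == 1%N.
  apply/eqP/(cser_exp_dvd he'); rewrite coprimep_sym in copX.
  by rewrite -(Gauss_dvdpr _ copX) -E; exact: dvdp_mulr.
move: E; rewrite dE cE -!rmorphXn /= !mul_polyC => E.
have := congr1 (fun w : {poly K} => w`_0) E.
rewrite /= !coefZ !coef0_prod_cser !mulr1 => cd.
move: E; rewrite cd => /(scalerI (expf_neq0 _ d0)).
exact: (prod_cser_inj charK k_big p_big).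
Qed.

Let charKX : p \in [pchar {poly K}]. Proof. by rewrite pchar_poly. Qed.

Definition cmon (m : 'X_{1..n}) (s : nat) : {poly K} :=
  \prod_(i < n) cser K (i + 2) (p ^ s) ^+ m i.

(** Stands for B^(-m), multiplied by B^D to stay polynomial. *)
Let cowt (m : 'X_{1..n}) : {poly K} := \prod_(i < n) B i ^+ (D - m i).

Lemma cowt_cmonS (m : 'X_{1..n}) s : (forall i, m i <= D)%N ->
  cowt m * cmon m s.+1 = (\prod_(i < n) B i ^+ D) * cmon m s ^+ p.
Proof.
move=> mD; rewrite /cowt /cmon -prodrXl -!big_split /=.
apply: eq_bigr => i _; rewrite (cserS charK) exprMn mulrA -exprD subnK //.
by rewrite -!exprM mulnC.
Qed.

(* Frobenius turns a relation with coefficients c_m into one with coefficients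
   c_m^p B^(D-m); eliminating one monomial gives a shorter relation. *)
Lemma cmon_indep (S : seq 'X_{1..n}) (c : 'X_{1..n} -> {poly K}) s0 :
    uniq S -> (forall m, m \in S -> forall i, m i <= D)%N ->
    (forall s, (s0 <= s)%N -> 'X^(p ^ s) %| \sum_(m <- S) c m * cmon m s) ->
  forall m, m \in S -> c m = 0.
Proof.
elim: S c s0 => [|b S IH] c s0 //= /andP[bS uS] SD rel.
have SD' m : m \in S -> forall i, (m i <= D)%N.
  by move=> mS; apply: SD; rewrite inE mS orbT.
have bD : forall i, (b i <= D)%N by apply: SD; rewrite inE eqxx.
suff cb0 : c b = 0.
  move=> m; rewrite inE => /orP[/eqP -> //|]; apply: (IH c s0) => // s /rel.
  by rewrite big_cons cb0 mul0r add0r.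
apply/eqP/negPn/negP => cb0.
(* The relation times c_b^p B^(D-b), minus c_b times its Frobenius image: the coefficient at b
   cancels. *)
pose c' m := c b ^+ p * cowt b * c m - c b * (c m ^+ p * cowt m).
have c'0 : forall m, m \in S -> c' m = 0.
  apply: (IH c' s0.+1) => // -[|s] //; rewrite ltnS => s0s.
  have -> : \sum_(m <- S) c' m * cmon m s.+1 = \sum_(m <- b :: S) c' m * cmon m s.+1.
    rewrite big_cons; have -> : c' b = 0 by rewrite /c' mulrAC -exprSr mulrA -exprS subrr.
    by rewrite mul0r add0r.
  have -> : \sum_(m <- b :: S) c' m * cmon m s.+1 =
      c b ^+ p * cowt b * (\sum_(m <- b :: S) c m * cmon m s.+1)
      - c b * (\prod_(i < n) B i ^+ D) * (\sum_(m <- b :: S) c m * cmon m s) ^+ p.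
    rewrite -[X in _ - _ * X](pFrobenius_autE charKX) raddf_sum !mulr_sumr -sumrB.
    apply: eq_big_seq => m mS; rewrite /c' mulrBl -!mulrA (cowt_cmonS s (SD m mS)) /=.
    by rewrite pFrobenius_autE exprMn; congr (_ - _ * _); rewrite mulrCA.
  rewrite dvdp_sub // dvdp_mull //; first by apply: rel; apply: leqW.
  by rewrite expnSr exprM dvdp_exp2r // rel.
have cS0 m : m \in S -> c m = 0.
  move=> mS; apply/eqP/negPn/negP => cm0.
  have := c'0 m mS; rewrite /c' => /eqP; rewrite subr_eq0 => /eqP E.
  have E' : c b ^+ p.-1 * cowt b = c m ^+ p.-1 * cowt m.
    apply: (mulfI cb0); apply: (mulfI cm0).
    have pE (x : {poly K}) : x ^+ p = x * x ^+ p.-1 by rewrite -exprS prednK.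
    by move: E; rewrite !pE => E; rewrite mulrC !mulrA E; ring.
  have bm : b = m; last by rewrite bm mS in bS.
  (* Exponents bounded by D are recovered from the truncated differences. *)
  apply/mnmP => i.
  have := @exp_prod_cser_inj _ _ (fun j => D - nth 0 b j)%N (fun j => D - nth 0 m j)%N
    (fun j => leq_subr _ _) (fun j => leq_subr _ _) cb0 cm0.
  have wE (m' : 'X_{1..n}) : \prod_(j < n) B j ^+ (D - nth 0%N m' j) = cowt m'.
    by apply: eq_bigr => j _; rewrite (mnm_nth 0%N).
  rewrite !wE => /(_ E' i (ltn_ord i)); rewrite -!mnm_nth => ?.
  by have := bD i; have := SD' m mS i; lia.
(* Only the term of b remains, and its monomial has constant term 1; so c_b is divisible by
   arbitrarily high powers of z. *)
have rel1 s : (s0 <= s)%N -> 'X^(p ^ s) %| c b.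
  move=> /rel; rewrite big_cons big1_seq ?addr0.
    rewrite Gauss_dvdpl // coprimep_expl // coprimep_sym coprimepX /root horner_prod.
    apply/prodf_neq0 => i _; rewrite horner_exp horner_coef0 coef_poly expn_gt0 p_gt0.
    by rewrite /cbin bin0 exp1n expr1n oner_neq0.
  by move=> m /andP[_ mS]; rewrite cS0 ?mul0r.
have := dvdp_leq cb0 (rel1 (s0 + size (c b))%N (leq_addr _ _)).
rewrite size_polyXn leqNgt => /negP; apply; apply: leq_trans (_ : (p ^ size (c b) < _)%N).
  by apply: ltnW; rewrite ltnS ltn_expl // p_odd; lia.
by rewrite ltnS leq_exp2l ?leq_addl // p_odd; lia.
Qed.

End Independence.

(** * Transfer from the g_r to the f_r *)

Section FIndependence.
Variables (K : closedFieldType) (p q n D k : nat).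
Hypothesis charK : p \in [pchar K].
Hypothesis p_odd : p = q.*2.+1.
Hypothesis q_gt0 : (0 < q)%N.
Hypothesis k_big : ((2 * k).+1 ^ (n.+1 + n * D) < 4 ^ k)%N.
Hypothesis p_big : (k.+1 ^ (n * D) * 4 ^ (n.+1 * k) < p)%N.
Hypothesis p_mult : (n * (D * n) < p.-1)%N.

(** Multiplying by B^D turns f^m into A^m B^(D-m) g^m, so [cmon_indep] applies to the coefficients
    [c m * w m]. *)
Lemma fser_indep (S : seq 'X_{1..n}) (c : 'X_{1..n} -> {poly K}) :
    uniq S -> (forall m, m \in S -> forall i, m i <= D)%N ->
    (forall N, 'X^N %|
       \sum_(m <- S) c m * \prod_(i < n) fser K (i + 2) N ^+ m i) ->
  forall m, m \in S -> c m = 0.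
Proof.
move=> uS SD rel.
pose w (m : 'X_{1..n}) : {poly K} :=
  \prod_(i < n) (fser K (i + 2) p ^+ m i * cser K (i + 2) p ^+ (D - m i)).
have p0 : (0 < p)%N by rewrite p_odd.
have w0 m : w m != 0.
  apply/prodf_neq0 => i _; rewrite mulf_neq0 ?expf_neq0 ?cser_neq0 //.
  apply/eqP => /(congr1 (fun u : {poly K} => u`_0)).
  rewrite coef_poly p0 coef0 /fcoef /cbin bin0 exp1n mulr1 => /eqP.
  by rewrite oner_eq0.
suff cw0 : forall m, m \in S -> c m * w m = 0.
  by move=> m /cw0 /eqP; rewrite mulf_eq0 (negPf (w0 m)) orbF => /eqP.
(* The start s0 = 1 fits [fser_cser], which concerns truncations at p^(s+1). *)
apply: (@cmon_indep K p q n D k charK p_odd q_gt0 k_big p_big p_mult S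
  (fun m => c m * w m) 1 uS SD) => -[|s] // _.
have -> : \sum_(m <- S) c m * w m * cmon K p m s.+1 =
   (\prod_(i < n) cser K (i + 2) p ^+ D) *
   \sum_(m <- S) c m * \prod_(i < n) fser K (i + 2) (p ^ s.+1) ^+ m i.
  rewrite mulr_sumr; apply: eq_big_seq => m mS; rewrite -mulrA [RHS]mulrCA; congr (_ * _).
  rewrite /w /cmon -!big_split /=; apply: eq_bigr => i _.
  rewrite mulrAC -exprMn -(fser_cser charK) ?addn2 // exprMn mulrAC -exprD subnKC //.
  exact: SD.
exact/dvdp_mull/rel.
Qed.

End FIndependence.

(** * Integral relations and the choice of the prime *)

Lemma clear_denominators n (P : {mpoly {poly rat}[n]}) :
  exists a : int, exists Q : {mpoly {poly int}[n]},
    a != 0 /\ map_mpoly (map_poly intr) Q = (a%:~R)%:P *: P.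
Proof.
elim/mpolyind: P => [|c m P _ _ [a [Q [a0 QE]]]].
  by exists 1, 0; split => //; rewrite rmorph0 scaler0.
have [c' [b b0 cE]] := rat_poly_scale c.
have b0' : b%:~R != 0 :> rat by rewrite intr_eq0.
exists (a * b), ((a%:P * c') *: 'X_[m] + b%:P *: Q); split.
  by rewrite mulf_neq0.
rewrite raddfD /= !map_mpolyZ map_mpolyX /= QE rmorphM /= !map_polyC /=.
have -> : map_poly intr c' = (b%:~R)%:P * c.
  by rewrite cE mul_polyC scalerA divff // scale1r.
by rewrite scalerDr !scalerA intrM rmorphM /= !mulrA [in X in _ + X]mulrC.
Qed.

Lemma meval_map_inj n (R S : comNzRingType) (f : {rmorphism R -> S})
    (Q : {mpoly R[n]}) (v : 'I_n -> R) : injective f ->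
  (map_mpoly f Q).@[fun i => f (v i)] = f (Q.@[v]).
Proof.
move=> f_inj; rewrite !mevalE (perm_big _ (msupp_map_mpoly Q f_inj)) rmorph_sum.
apply: eq_bigr => m _; rewrite mcoeff_map_mpoly rmorphM rmorph_prod /=.
by congr (_ * _); apply: eq_bigr => i _; rewrite rmorphXn.
Qed.

(** Agreement up to degree k is preserved by sums and products; it allows [series_eval] to be
    computed with longer truncations. *)
Lemma coef_meval_congr n (R : comNzRingType) (P : {mpoly {poly R}[n]})
    (u v : 'I_n -> {poly R}) k :
    (forall i j, (j <= k)%N -> (u i)`_j = (v i)`_j) ->
  (P.@[u])`_k = (P.@[v])`_k.
Proof.
move=> uv; pose eqk (x y : {poly R}) := forall j, (j <= k)%N -> x`_j = y`_j.
have eqM x y x' y' : eqk x x' -> eqk y y' -> eqk (x * y) (x' * y').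
  move=> hx hy j jk; rewrite !coefM; apply: eq_bigr => i _.
  have ij : (i <= j)%N by rewrite -ltnS.
  by rewrite hx ?hy //; lia.
suff: eqk P.@[u] P.@[v] by apply.
rewrite !mevalE => j jk; rewrite !coef_sum; apply: eq_bigr => m _.
move: j jk; apply: (eqM) => //; apply: (big_ind2 eqk) => // [x x' y y' hx hy|i _]; first exact: eqM.
by elim: (m i) => [|d IH] //; rewrite !exprS; apply: eqM => // j; apply: uv.
Qed.

Lemma dvdXn_coef (F : fieldType) (u : {poly F}) N :
  (forall j, (j < N)%N -> u`_j = 0) -> 'X^N %| u.
Proof.
move=> u0; rewrite -(poly_take_drop N u) dvdp_addr ?dvdp_mulIr //.
have -> : take_poly N u = 0; last exact: dvdp0.
by apply/polyP => j; rewrite coef_take_poly coef0; case: ifP => // /u0.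
Qed.

Lemma frak_f_alg_indep n : alg_indep_series (fun i : 'I_n => frak_f (i + 2)%N).
Proof.
move=> P rel; apply/eqP/negPn/negP => P0.
have [a [Q [a0 QE]]] := clear_denominators P.
pose v N (i : 'I_n) : {poly int} := \poly_(j < N) fcoef (i + 2) j.
have vE N i : map_poly intr (v N i) = trunc (frak_f (i + 2)%N) N.
  apply/polyP => j; rewrite coef_map !coef_poly.
  by case: ifP => //= _; rewrite frak_fE // addn2.
have relZ N j : (j < N)%N -> (Q.@[v N])`_j = 0.
  move=> jN; apply/eqP; rewrite -(intr_eq0 rat) -coef_map /=.
  rewrite -(@meval_map_inj n _ _ (map_poly intr)); last first.
    by apply: map_inj_poly => //; exact: intr_inj.
  rewrite QE mevalZ mul_polyC coefZ mulf_eq0; apply/orP; right.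
  apply/eqP; rewrite -[RHS](rel j); apply: coef_meval_congr => i l lj.
  by rewrite /= vE !coef_poly ltnS lj (leq_ltn_trans lj jN).
have [m mP] : exists m, m \in msupp P.
  by case: (msupp P) (msupp_eq0 P) => [|m s] h; [rewrite -h in P0|exists m; rewrite inE eqxx].
have Qm0 : Q@_m != 0.
  rewrite mcoeff_msupp in mP; apply: contraNneq mP => Qm0.
  have := congr1 (mcoeff m) QE; rewrite mcoeff_map_mpoly Qm0 /= map_poly0 mcoeffZ.
  by move/esym/eqP; rewrite mulf_eq0 polyC_eq0 intr_eq0 (negPf a0).
have mQ : m \in msupp Q by rewrite mcoeff_msupp.
have [j zj] : exists j, (Q@_m)`_j != 0.
  by exists (size Q@_m).-1; rewrite -lead_coefE lead_coef_eq0.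
set z := _`_j in zj.
pose D := msize Q.
have [k k_big] := exp_lt_exp4 (n.+1 + n * D).
(* The summands secure in turn that p is odd with q > 0, [p_big], [p_mult], and that p does not
   divide the nonzero integer z. *)
have [p p_big p_pr] := prime_above
  (3 + k.+1 ^ (n * D) * 4 ^ (n.+1 * k) + n * (D * n) + `|z|)%N.
have p_odd : p = p./2.*2.+1.
  by rewrite -[LHS]odd_double_half; case: (even_prime p_pr) p_big => [->|->] //; lia.
have [K [f _]] := countable_algebraic_closure 'F_p.
have charK : p \in [pchar K] by apply: (rmorph_pchar f); exact: pchar_Fp.
(* Independence over K forces p to divide every coefficient of [Q@_m], in particular z, although p >
   |z| > 0. *)
have : map_poly intr Q@_m = 0 :> {poly K}.
  apply: (@fser_indep K p p./2 n D k charK p_odd _ k_big _ _ (msupp Q)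
    (fun m => map_poly intr Q@_m) (msupp_uniq Q) _ _ m mQ).
  - lia.
  - lia.
  - lia.
  - move=> m' /msize_mdeg_lt; rewrite -/D mdegE => mD i; apply: ltnW.
    by apply: leq_ltn_trans mD; rewrite (bigD1 i) //= leq_addr.
  - move=> N; apply: dvdXn_coef => l lN.
    have <- : map_poly intr Q.@[v N] = \sum_(m <- msupp Q) map_poly intr Q@_m *
        \prod_(i < n) fser K (i + 2) N ^+ m i.
      rewrite mevalE rmorph_sum; apply: eq_bigr => m' _; rewrite rmorphM rmorph_prod /=.
      congr (_ * _); apply: eq_bigr => i _; rewrite rmorphXn; congr (_ ^+ _).
      by apply/polyP => l'; rewrite coef_map !coef_poly /=; case: ifP.
    by rewrite coef_map relZ ?rmorph0.
move/(congr1 (fun u : {poly K} => u`_j)); rewrite coef_map coef0 /= -/z => /eqP.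
rewrite -(dvdz_pcharf charK) dvdzE => /dvdn_leq; rewrite absz_gt0 => /(_ zj).
by rewrite absz_nat; lia.
Qed.

Theorem theorem2 (l : nat) (hl : (2 <= l)%N) :
  alg_indep_series (fun i : 'I_(l.-1) => frak_f (i + 2)%N).
Proof. exact: frak_f_alg_indep. Qed.
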